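(* The deep inference system $\mathsf{KS1}$ is sound and complete for first-order logic: a formula $A$ is provable in $\mathsf{KS1}$ (i.e., there is a $\mathsf{KS1}$-derivation with premise $\mathsf t$ and conclusion $A$) if and only if $A$ is valid (true in every first-order structure under every assignment of the variables).
   Context: Fix pairwise disjoint countably infinite sets of variables, function symbols and predicate symbols, each symbol with a finite arity; each predicate symbol $p$ has a dual predicate symbol $\bar p$ with $\bar{\bar p}=p\neq\bar p$. Terms: $t::=x\mid f(t_1,\dots,t_n)$. Atoms: $a::=\mathsf t\mid\mathsf f\mid p(t_1,\dots,t_n)\mid\bar p(t_1,\dots,t_n)$ where $\mathsf t$ means true and $\mathsf f$ means false, and $\bar p(\vec t)$ is interpreted as the negation of $p(\vec t)$. Formulas (negation normal form): $A::=a\mid A\wedge A\mid A\vee A\mid\exists x.A\mid\forall x.A$. Negation $\bar{\cdot}$ is defined by $\bar{\mathsf t}=\mathsf f$, $\bar{\mathsf f}=\mathsf t$, $\overline{p(\vec t)}=\bar p(\vec t)$, $\overline{\bar p(\vec t)}=p(\vec t)$ and De Morgan laws. $A[x/t]$ denotes substitution of $t$ for $x$. The equivalence $\equiv$ is the smallest congruence on formulas with: $\wedge$ and $\vee$ commutative and associative; $\forall x.\forall y.A\equiv\forall y.\forall x.A$; $\exists x.\exists y.A\equiv\exists y.\exists x.A$; $\forall x.(A\vee B)\equiv(\forall x.A)\vee B$ and $\exists x.(A\wedge B)\equiv(\exists x.A)\wedge B$ when $x$ is not free in $B$. A context $S\{\ \}$ is a formula with exactly one occurrence of a hole in place of an atom;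 $S\{A\}$ is the result of filling the hole with $A$. A derivation in a rule system from premise $B$ to conclusion $A$ is a finite sequence of formulas starting with $B$ and ending with $A$ in which each formula is obtained from the previous one by an instance of a rule. The rules of $\mathsf{KS1}$ (written premise $\Rightarrow$ conclusion, usable in any context $S$): $\forall$: $S\{\mathsf t\}\Rightarrow S\{\forall x.\mathsf t\}$; $\mathsf{ai}$: $S\{\mathsf t\}\Rightarrow S\{a\vee\bar a\}$ ($a$ an atom); $\mathsf t$-rule: $S\{A\}\Rightarrow S\{A\wedge\mathsf t\}$; $\mathsf s$: $S\{A\wedge(B\vee C)\}\Rightarrow S\{(A\wedge B)\vee C\}$; $\mathsf{mix}$: $S\{A\wedge B\}\Rightarrow S\{A\vee B\}$; $\exists$: $S\{A[x/t]\}\Rightarrow S\{\exists x.A\}$ ($t$ any term); $\equiv$: $S\{B\}\Rightarrow S\{A\}$ whenever $A\equiv B$; $\mathsf w$: $S\{A\}\Rightarrow S\{A\vee B\}$; $\mathsf m$: $S\{(A\wedge C)\vee(B\wedge D)\}\Rightarrow S\{(A\vee B)\wedge(C\vee D)\}$; $\mathsf{ac}$: $S\{a\vee a\}\Rightarrow S\{a\}$ ($a$ an atom); $\mathsf m_\forall$: $S\{(\forall x.A)\vee(\forall x.B)\}\Rightarrow S\{\forall x.(A\vee B)\}$; $\mathsf m_\exists$: $S\{(\exists x.A)\vee(\exists x.B)\}\Rightarrow S\{\exists x.(A\vee B)\}$; $\mathsf w_\forall$: $S\{A\}\Rightarrow S\{\forall x.A\}$ ($x$ not free in $A$); $\mathsf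 c_\forall$: $S\{\forall x.\forall x.A\}\Rightarrow S\{\forall x.A\}$. A formula is provable in a system if there is a derivation in it from $\mathsf t$ to the formula. *)

(* Defs.v *)
From HB Require Import structures.
From mathcomp Require Import all_boot.

Set Implicit Arguments.
Unset Strict Implicit.
Unset Printing Implicit Defensive.

Definition infinite (T : eqType) : Prop :=
  forall s : seq T, exists x, x \notin s.

(* The arities of the symbols are arbitrary. A symbol and its dual must have  *)
(* the same arity for the dual atom to be an atom.                            *)
Record signature := Signature {
  var : countType;
  fsym : countType;
  psym : countType;
  var_infinite : infinite var;
  fsym_infinite : infinite fsym;
  psym_infinite : infinite psym;
  farity : fsym -> nat;
  parity : psym -> nat;
  dual : psym -> psym;
  dualK : involutive dual;
  dual_neq : forall p, dual p != p;
  parity_dual : forall p, parity (dual p) = parity p }.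

Section Syntax.
Variable L : signature.

Inductive term : Type :=
  | Var of var L
  | App (f : fsym L) of {ffun 'I_(farity f) -> term}.

Inductive atom : Type :=
  | ATrue
  | AFalse
  | APred (p : psym L) of {ffun 'I_(parity p) -> term}.

Inductive formula : Type :=
  | Atom of atom
  | And of formula & formula
  | Or of formula & formula
  | Ex of var L & formula
  | All of var L & formula.

Definition dual_atom (a : atom) : atom :=
  match a with
  | ATrue => AFalse
  | AFalse => ATrue
  | APred p ts =>
      @APred (dual p) [ffun i => ts (cast_ord (parity_dual p) i)]
  end.

Fixpoint term_vars (t : term) : seq (var L) :=
  match t with
  | Var x => [:: x]
  | App f ts => flatten [seq term_vars (ts i) | i <- enum 'I_(farity f)]
  end.

Definition atom_vars (a : atom) : seq (var L) :=
  match a with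
  | APred p ts => flatten [seq term_vars (ts i) | i <- enum 'I_(parity p)]
  | _ => [::]
  end.

Fixpoint free_vars (A : formula) : seq (var L) :=
  match A with
  | Atom a => atom_vars a
  | And B C | Or B C => free_vars B ++ free_vars C
  | Ex x B | All x B => [seq y <- free_vars B | y != x]
  end.

Fixpoint term_subst (s : var L -> term) (t : term) : term :=
  match t with
  | Var x => s x
  | App f ts => @App f [ffun i => term_subst s (ts i)]
  end.

Definition atom_subst (s : var L -> term) (a : atom) : atom :=
  match a with
  | APred p ts => @APred p [ffun i => term_subst s (ts i)]
  | _ => a
  end.

Definition variant (x : var L) (avoid : seq (var L)) : var L :=
  if x \in avoid then xchoose (var_infinite avoid) else x.

(* The bound variable to be used when [s] is pushed under a quantifier on [x] *)
(* with body [A]: it is [x] itself unless that would capture a variable.      *)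
Definition binder (s : var L -> term) (x : var L) (A : formula) : var L :=
  variant x
    (flatten [seq term_vars (s y) | y <- free_vars A & y != x]).

Fixpoint msubst (s : var L -> term) (A : formula) : formula :=
  match A with
  | Atom a => Atom (atom_subst s a)
  | And B C => And (msubst s B) (msubst s C)
  | Or B C => Or (msubst s B) (msubst s C)
  | Ex x B =>
      let z := binder s x B in
      Ex z (msubst (fun y => if y == x then Var z else s y) B)
  | All x B =>
      let z := binder s x B in
      All z (msubst (fun y => if y == x then Var z else s y) B)
  end.

Definition subst (A : formula) (x : var L) (t : term) : formula :=
  msubst (fun y => if y == x then t else Var y) A.

(* Formulas are understood up to renaming of bound variables. As [formula] is *)
(* the raw syntax, this identification is expressed by the two alpha clauses, *)
(* so that [equiv] is the pullback to raw formulas of the congruence on       *)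
(* alpha-classes generated by the remaining clauses. Reading the rules on raw *)
(* formulas instead would lose completeness, for example on the valid formula *)
(*   (exists y. ~r(x,y)) \/ (exists v. exists w. r(v,w) /\ s(w))              *)
(*     \/ forall x. ~s(x)                                                     *)
(* where [x] is both free and bound.                                          *)
Inductive equiv : formula -> formula -> Prop :=
  | equiv_refl A : equiv A A
  | equiv_sym A B : equiv A B -> equiv B A
  | equiv_trans A B C : equiv A B -> equiv B C -> equiv A C
  | equiv_And A A' B B' :
      equiv A A' -> equiv B B' -> equiv (And A B) (And A' B')
  | equiv_Or A A' B B' :
      equiv A A' -> equiv B B' -> equiv (Or A B) (Or A' B')
  | equiv_Ex x A A' : equiv A A' -> equiv (Ex x A) (Ex x A')
  | equiv_All x A A' : equiv A A' -> equiv (All x A) (All x A')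
  | equiv_AndC A B : equiv (And A B) (And B A)
  | equiv_AndA A B C : equiv (And A (And B C)) (And (And A B) C)
  | equiv_OrC A B : equiv (Or A B) (Or B A)
  | equiv_OrA A B C : equiv (Or A (Or B C)) (Or (Or A B) C)
  | equiv_AllC x y A : equiv (All x (All y A)) (All y (All x A))
  | equiv_ExC x y A : equiv (Ex x (Ex y A)) (Ex y (Ex x A))
  | equiv_AllOr x A B :
      x \notin free_vars B -> equiv (All x (Or A B)) (Or (All x A) B)
  | equiv_ExAnd x A B :
      x \notin free_vars B -> equiv (Ex x (And A B)) (And (Ex x A) B)
  | equiv_alpha_All x y A :
      y \notin free_vars A -> equiv (All x A) (All y (subst A x (Var y)))
  | equiv_alpha_Ex x y A :
      y \notin free_vars A -> equiv (Ex x A) (Ex y (subst A x (Var y))).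

Inductive context : Type :=
  | Hole
  | CAndl of context & formula
  | CAndr of formula & context
  | COrl of context & formula
  | COrr of formula & context
  | CEx of var L & context
  | CAll of var L & context.

(* Quantifiers of the context do bind variables of the plugged formula.       *)
Fixpoint fill (S : context) (A : formula) : formula :=
  match S with
  | Hole => A
  | CAndl S' B => And (fill S' A) B
  | CAndr B S' => And B (fill S' A)
  | COrl S' B => Or (fill S' A) B
  | COrr B S' => Or B (fill S' A)
  | CEx x S' => Ex x (fill S' A)
  | CAll x S' => All x (fill S' A)
  end.

Definition rule_system := formula -> formula -> Prop.

Definition inference (R : rule_system) (P Q : formula) : Prop :=
  exists S A B, [/\ R A B, P = fill S A & Q = fill S B].

Fixpoint chain (R : rule_system) (B : formula) (s : seq formula) : Prop :=
  if s is C :: s' then inference R B C /\ chain R C s' else True.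

Definition derivable (R : rule_system) (B A : formula) : Prop :=
  exists s : seq formula, chain R B s /\ last B s = A.

Definition ftrue : formula := Atom ATrue.

Definition provable (R : rule_system) (A : formula) : Prop :=
  derivable R ftrue A.

(* Premise first, conclusion second. *)
Inductive KS1 : rule_system :=
  | KS1_forall x : KS1 ftrue (All x ftrue)
  | KS1_ai a : KS1 ftrue (Or (Atom a) (Atom (dual_atom a)))
  | KS1_t A : KS1 A (And A ftrue)
  | KS1_s A B C : KS1 (And A (Or B C)) (Or (And A B) C)
  | KS1_mix A B : KS1 (And A B) (Or A B)
  | KS1_exists A x t : KS1 (subst A x t) (Ex x A)
  | KS1_equiv A B : equiv A B -> KS1 B A
  | KS1_w A B : KS1 A (Or A B)
  | KS1_m A B C D :
      KS1 (Or (And A C) (And B D)) (And (Or A B) (Or C D))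
  | KS1_ac a : KS1 (Or (Atom a) (Atom a)) (Atom a)
  | KS1_mforall x A B : KS1 (Or (All x A) (All x B)) (All x (Or A B))
  | KS1_mexists x A B : KS1 (Or (Ex x A) (Ex x B)) (Ex x (Or A B))
  | KS1_wforall x A : x \notin free_vars A -> KS1 A (All x A)
  | KS1_cforall x A : KS1 (All x (All x A)) (All x A).

End Syntax.

Section Semantics.
Variable L : signature.

Record structure := Structure {
  dom : Type;
  dom_inhabited : inhabited dom;
  fint : forall f : fsym L, {ffun 'I_(farity f) -> dom} -> dom;
  pint : forall p : psym L, {ffun 'I_(parity p) -> dom} -> Prop;
  pint_dual : forall (p : psym L) (v : {ffun 'I_(parity p) -> dom}),
    @pint (dual p) [ffun i => v (cast_ord (parity_dual p) i)] <->
    ~ @pint p v }.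

Variable M : structure.

Fixpoint eval (e : var L -> dom M) (t : term L) : dom M :=
  match t with
  | Var x => e x
  | App f ts => fint [ffun i => eval e (ts i)]
  end.

Definition atom_holds (e : var L -> dom M) (a : atom L) : Prop :=
  match a with
  | ATrue => True
  | AFalse => False
  | APred p ts => pint [ffun i => eval e (ts i)]
  end.

Fixpoint holds (e : var L -> dom M) (A : formula L) : Prop :=
  match A with
  | Atom a => atom_holds e a
  | And B C => holds e B /\ holds e C
  | Or B C => holds e B \/ holds e C
  | Ex x B => exists d, holds (fun y => if y == x then d else e y) B
  | All x B => forall d, holds (fun y => if y == x then d else e y) B
  end.

End Semantics.

Definition valid (L : signature) (A : formula L) : Prop :=
  forall (M : structure L) (e : var L -> dom M), holds e A.

(* Main.v *)
(* Completeness. In KS1 disjunction is a join for derivability, since general *)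
(* contraction reduces to the atomic one, and the rules of a cut-free sequent *)
(* calculus are derivable on disjunctions. If [A0] is not provable, run       *)
(* through an enumeration of all formulas and add each formula to a finite    *)
(* set, with a fresh variable as witness if it is universal, whenever the     *)
(* disjunction of the set and [A0] remains unprovable. The union of these     *)
(* sets contains [A0] and, without any use of cut, is seen to be the dual of  *)
(* a Hintikka set, so all its members are false in a structure on the terms.  *)
From HB Require Import structures.
From mathcomp Require Import all_boot boolp.
Require Import Defs.

Set Implicit Arguments.
Unset Strict Implicit.
Unset Printing Implicit Defensive.

(** Soundness: each rule preserves truth under every assignment, and contexts are monotone because
    formulas contain no negation above atoms; so truth travels down a derivation
    ([derivable_sound]).

    Completeness is by contraposition and avoids cut. Weakening and contraction make disjunction a
    join for derivability, so finite sets of formulas can be handled through their disjunction with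
    the unprovable [A0]. The set [limit] grows from these as a maximal ideal without provable
    member. It is closed downwards ([limit_derivable]), which settles disjunctions and existentials;
    maximality and [provable_OrAnd] make it prime for conjunctions ([limit_And]); fresh variables,
    harmless by [provable_OrAll], witness its universal members ([limit_All]).

    That one of two dual atoms lies in [limit] is never shown, as this would use cut. Hence
    [dual_hintikka_refuted] goes one way only: members of [limit] are false in the term model, with
    no claim that the others are true. Since [A0] is a member ([limit_base]), it is not valid. *)

(** * Countability of terms, atoms and formulas *)

Section Countability.
Variable L : signature.

(** Structural induction with hypotheses for the arguments, which are nested inside a finite
    function. *)
Fixpoint term_nested_ind (P : term L -> Prop) (PVar : forall x, P (Var x))
    (PApp : forall f (ts : {ffun 'I_(farity f) -> term L}),
      (forall i, P (ts i)) -> P (App ts)) (t : term L) : P t :=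
  match t with
  | Var x => PVar x
  | App f ts => PApp f ts (fun i => term_nested_ind PVar PApp (ts i))
  end.

(** Any term would do: it pads lists in the decoders and later inhabits the domain of the term
    model. *)
Definition default_term : term L := Var (xchoose (var_infinite [::])).

Lemma nth_codom_ord (T : Type) (d : T) n (f : 'I_n -> T) (i : 'I_n) :
  nth d [seq f j | j <- enum 'I_n] i = f i.
Proof. by rewrite (nth_map i) ?size_enum_ord // nth_ord_enum. Qed.

Fixpoint term_encode (t : term L) : GenTree.tree (var L) :=
  match t with
  | Var x => GenTree.Leaf x
  | App f ts =>
      GenTree.Node (pickle f) [seq term_encode (ts i) | i <- enum 'I_(farity f)]
  end.

Fixpoint term_decode (u : GenTree.tree (var L)) : term L :=
  match u with
  | GenTree.Leaf x => Var x
  | GenTree.Node n us =>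
      if unpickle n is Some f then
        @App L f [ffun i : 'I_(farity f) => nth default_term (map term_decode us) i]
      else default_term
  end.

Lemma term_encodeK : cancel term_encode term_decode.
Proof.
elim/term_nested_ind => [//|f ts IH] /=; rewrite pickleK; congr App.
by apply/ffunP => i; rewrite ffunE -map_comp nth_codom_ord /= IH.
Qed.

HB.instance Definition _ := Countable.copy (term L) (can_type term_encodeK).

Definition atom_encode (a : atom L) : bool + psym L * seq (term L) :=
  match a with
  | ATrue => inl true
  | AFalse => inl false
  | APred p ts => inr (p, [seq ts i | i <- enum 'I_(parity p)])
  end.

Definition atom_decode (c : bool + psym L * seq (term L)) : atom L :=
  match c with
  | inl b => if b then ATrue L else AFalse L
  | inr (p, us) => @APred L p [ffun i => nth default_term us (i : 'I_(parity p))]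
  end.

Lemma atom_encodeK : cancel atom_encode atom_decode.
Proof.
case=> [||p ts] //=; congr APred.
by apply/ffunP => i; rewrite ffunE nth_codom_ord.
Qed.

HB.instance Definition _ := Countable.copy (atom L) (can_type atom_encodeK).

Fixpoint formula_encode (A : formula L) : GenTree.tree (atom L + var L) :=
  match A with
  | Atom a => GenTree.Leaf (inl a)
  | And B C => GenTree.Node 0 [:: formula_encode B; formula_encode C]
  | Or B C => GenTree.Node 1 [:: formula_encode B; formula_encode C]
  | Ex x B => GenTree.Node 2 [:: GenTree.Leaf (inr x); formula_encode B]
  | All x B => GenTree.Node 3 [:: GenTree.Leaf (inr x); formula_encode B]
  end.

Fixpoint formula_decode (u : GenTree.tree (atom L + var L)) : formula L :=
  match u with
  | GenTree.Leaf (inl a) => Atom a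
  | GenTree.Node 0 [:: u1; u2] => And (formula_decode u1) (formula_decode u2)
  | GenTree.Node 1 [:: u1; u2] => Or (formula_decode u1) (formula_decode u2)
  | GenTree.Node 2 [:: GenTree.Leaf (inr x); u1] => Ex x (formula_decode u1)
  | GenTree.Node 3 [:: GenTree.Leaf (inr x); u1] => All x (formula_decode u1)
  | _ => ftrue L
  end.

Lemma formula_encodeK : cancel formula_encode formula_decode.
Proof. by elim=> //= [A -> B ->|A -> B ->|x A ->|x A ->]. Qed.

HB.instance Definition _ := Countable.copy (formula L) (can_type formula_encodeK).

End Countability.

(** * Substitution lemma and soundness *)

Section Semantics.
Variables (L : signature) (M : structure L).
Implicit Types (e : var L -> dom M) (A B : formula L).

Lemma mem_arg_vars n (ts : 'I_n -> term L) i x : x \in term_vars (ts i) ->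
  x \in flatten [seq term_vars (ts j) | j <- enum 'I_n].
Proof.
move=> xi; apply/flattenP; exists (term_vars (ts i)) => //.
by apply/mapP; exists i; rewrite ?mem_enum.
Qed.

Lemma eval_ext e e' (t : term L) :
  {in term_vars t, e =1 e'} -> eval e t = eval e' t.
Proof.
elim/term_nested_ind: t => [x|f ts IH] /= ee'; first by apply: ee'; rewrite inE.
by congr fint; apply/ffunP => i; rewrite !ffunE; apply: IH => x /mem_arg_vars/ee'.
Qed.

Lemma holds_ext e e' A :
  {in free_vars A, e =1 e'} -> holds e A <-> holds e' A.
Proof.
have binder_ext x B (d : dom M) e1 e2 : {in free_vars (Ex x B), e1 =1 e2} ->
    {in free_vars B, (fun y => if y == x then d else e1 y) =1
                     (fun y => if y == x then d else e2 y)}.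
  by move=> e12 y By; case: eqP => // /eqP yx; apply: e12; rewrite mem_filter yx.
elim: A e e' => [[||p ts]|B IHB C IHC|B IHB C IHC|x B IHB|x B IHB] e e' ee' //=.
- rewrite (_ : [ffun i => eval e (ts i)] = [ffun i => eval e' (ts i)]) //.
  by apply/ffunP => i; rewrite !ffunE; apply: eval_ext => x /mem_arg_vars/ee'.
- rewrite (IHB e e') ?(IHC e e') // => x Ax;
    by apply: ee'; rewrite mem_cat Ax ?orbT.
- rewrite (IHB e e') ?(IHC e e') // => x Ax;
    by apply: ee'; rewrite mem_cat Ax ?orbT.
- by split=> -[d Bd]; exists d; apply/(IHB _ _ (binder_ext _ _ d _ _ ee')).
- by split=> Bd d; apply/(IHB _ _ (binder_ext _ _ d _ _ ee')).
Qed.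

Lemma holds_fresh e x d A : x \notin free_vars A ->
  holds (fun y => if y == x then d else e y) A <-> holds e A.
Proof.
move=> xA; apply: holds_ext => y Ay; case: eqP => // yx.
by rewrite -yx Ay in xA.
Qed.

Lemma eval_subst e s (t : term L) :
  eval e (term_subst s t) = eval (fun y => eval e (s y)) t.
Proof.
elim/term_nested_ind: t => //= f ts IH; congr fint.
by apply/ffunP => i; rewrite !ffunE.
Qed.

Lemma variant_notin (x : var L) avoid : variant x avoid \notin avoid.
Proof.
by rewrite /variant; case: ifPn => // _; apply: (xchooseP (var_infinite avoid)).
Qed.

Lemma holds_msubst e s A :
  holds e (msubst s A) <-> holds (fun y => eval e (s y)) A.
Proof.
have binderE x B (d : dom M) e1 s1 : {in free_vars B,
    (fun y => eval (fun v => if v == binder s1 x B then d else e1 v)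
                   (if y == x then Var (binder s1 x B) else s1 y)) =1
    (fun y => if y == x then d else eval e1 (s1 y))}.
  move=> y By; case: (eqVneq y x) => [_|yx] /=; first by rewrite eqxx.
  (* The binder was chosen outside the variables of [s1 y], so reassigning it leaves the value of
     [s1 y] unchanged. *)
  apply: eval_ext => v vy; case: eqP => // vz.
  have /negP[] := variant_notin x
    (flatten [seq term_vars (s1 y) | y <- free_vars B & y != x]).
  rewrite -[variant _ _]/(binder s1 x B) -vz; apply/flattenP.
  by exists (term_vars (s1 y)) => //; apply: map_f; rewrite mem_filter yx.
elim: A e s => [[||p ts]|B IHB C IHC|B IHB C IHC|x B IHB|x B IHB] e s //=.
- rewrite (_ : [ffun i => eval e _] =
    [ffun i => eval (fun y => eval e (s y)) (ts i)]) //.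
  by apply/ffunP => i; rewrite !ffunE eval_subst.
- by rewrite IHB IHC.
- by rewrite IHB IHC.
- by split=> -[d Bd]; exists d; move: Bd; rewrite IHB (holds_ext (binderE _ _ _ _ _)).
- by split=> Bd d; move: (Bd d); rewrite IHB (holds_ext (binderE _ _ _ _ _)).
Qed.

Lemma holds_subst e A x t :
  holds e (subst A x t) <-> holds (fun y => if y == x then eval e t else e y) A.
Proof. by rewrite holds_msubst; apply: holds_ext => y _; case: eqP. Qed.

Lemma holds_rename e A x y d : y \notin free_vars A ->
  holds (fun v => if v == y then d else e v) (subst A x (Var y)) <->
  holds (fun v => if v == x then d else e v) A.
Proof.
move=> yA; rewrite holds_subst /= eqxx; apply: holds_ext => v Av.
by case: eqP => // _; case: eqP => // vy; rewrite -vy Av in yA.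
Qed.

Lemma holds_swap e x y d d' A : x != y ->
  holds (fun v => if v == y then d' else if v == x then d else e v) A <->
  holds (fun v => if v == x then d else if v == y then d' else e v) A.
Proof.
move=> xy; apply: holds_ext => v _.
by case: eqP => // ->; rewrite eq_sym (negbTE xy).
Qed.

Lemma equiv_sound A B : equiv A B -> forall e, holds e A <-> holds e B.
Proof.
elim=> {A B} [A|A B _ IH|A B C _ IH1 _ IH2|A A' B B' _ IH1 _ IH2|
  A A' B B' _ IH1 _ IH2|x A A' _ IH|x A A' _ IH|A B|A B C|A B|A B C|
  x y A|x y A|x A B xB|x A B xB|x y A yA|x y A yA] e //=.
- by rewrite IH.
- by rewrite IH1 IH2.
- by rewrite IH1 IH2.
- by rewrite IH1 IH2.
- by split=> -[d] /IH; exists d.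
- by split=> Ad d; apply/IH.
- tauto.
- tauto.
- tauto.
- tauto.
- have [-> //|xy] := eqVneq x y.
  by split=> H d d'; apply/holds_swap => //; rewrite eq_sym.
- have [-> //|xy] := eqVneq x y.
  by split=> -[d [d' H]]; exists d', d; apply/holds_swap => //; rewrite eq_sym.
- split=> [H|[H|Be] d].
  (* Moving a universal quantifier off a disjunct is classical: decide [B], which does not depend on
     the bound variable. *)
  + have [Be|nBe] := EM (holds e B); first by right.
    by left=> d; case: (H d) => // /(holds_fresh e d xB).
  + by left; apply: H.
  + by right; apply/(holds_fresh e d xB).
- split=> [[d [Ad /(holds_fresh e d xB)]]|[[d Ad] Be]]; first by split=> //; exists d.
  by exists d; split=> //; apply/(holds_fresh e d xB).
- by split=> H d; move: (H d); rewrite holds_rename.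
- by split=> -[d H]; exists d; move: H; rewrite holds_rename.
Qed.

Lemma dual_atom_holds e a : atom_holds e (dual_atom a) <-> ~ atom_holds e a.
Proof.
case: a => [||p ts] /=; try tauto; rewrite -pint_dual.
by rewrite (_ : [ffun i => eval e _] =
  [ffun i => [ffun i0 => eval e (ts i0)] (cast_ord (parity_dual p) i)]) //;
  apply/ffunP => i; rewrite !ffunE.
Qed.

Lemma KS1_sound A B : KS1 A B -> forall e, holds e A -> holds e B.
Proof.
case=> {A B} [x|a|A|A B C|A B|A x t|A B AB|A B|A B C D|a|x A B|x A B|x A xA|x A] e //=;
  try tauto.
- by move=> _; rewrite dual_atom_holds; apply: EM.
- by rewrite holds_subst; exists (eval e t).
- by rewrite (equiv_sound AB).
- by move=> [] H d; [left | right].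
- by case=> -[d H]; exists d; [left | right].
- by move=> Ae d; apply/(holds_fresh e d xA).
(* The inner quantifier shadows the outer one, so the same value can serve for both. *)
- move=> H d; move: (H d d).
  rewrite (@holds_ext _ (fun y => if y == x then d else e y)) //.
  by move=> y _; case: eqP.
Qed.

(** The hypothesis ranges over all assignments because quantifiers of the context rebind variables
    of the plugged formula. *)
Lemma fill_sound S A B : (forall e, holds e A -> holds e B) ->
  forall e, holds e (fill S A) -> holds e (fill S B).
Proof.
move=> AB; elim: S => [|S IH C|C S IH|S IH C|C S IH|x S IH|x S IH] e //=.
- exact: AB.
- by move=> [/IH].
- by move=> [? /IH].
- by case=> [/IH|]; [left | right].
- by case=> [|/IH]; [left | right].
- by case=> d /IH; exists d.
- by move=> H d; apply: IH.
Qed.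

Lemma derivable_sound A B :
  derivable (@KS1 L) A B -> forall e, holds e A -> holds e B.
Proof.
case=> s [+ <-] e; elim: s A => //= C s IH A [[S [P [Q [PQ -> ->]]]] QC].
by move/(fill_sound (KS1_sound PQ))/IH; apply.
Qed.

End Semantics.

(** * Derivability as a preorder with joins, and sequent rules *)

Section Derivability.
Variable L : signature.
Implicit Types (A B C D G : formula L) (S : context L).

Local Notation "A ||- B" := (derivable (@KS1 L) A B) (at level 70).

Lemma derivable_refl A : A ||- A.
Proof. by exists [::]. Qed.

Lemma derivable_trans A B C : A ||- B -> B ||- C -> A ||- C.
Proof.
case=> s [As <-] [s' [Bs' <-]]; exists (s ++ s'); rewrite last_cat; split=> //.
elim: s A As Bs' => //= D s IH A [AD Ds] ss'.
by split=> //; apply: IH.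
Qed.

Lemma derivable_step S A B : KS1 A B -> fill S A ||- fill S B.
Proof.
move=> AB; exists [:: fill S B]; do 2!split=> //.
by exists S, A, B.
Qed.

Fixpoint context_comp S S' : context L :=
  match S with
  | Hole => S'
  | CAndl S1 B => CAndl (context_comp S1 S') B
  | CAndr B S1 => CAndr B (context_comp S1 S')
  | COrl S1 B => COrl (context_comp S1 S') B
  | COrr B S1 => COrr B (context_comp S1 S')
  | CEx x S1 => CEx x (context_comp S1 S')
  | CAll x S1 => CAll x (context_comp S1 S')
  end.

Lemma fill_comp S S' A : fill (context_comp S S') A = fill S (fill S' A).
Proof. by elim: S => //= [S -> B|B S ->|S -> B|B S ->|x S ->|x S ->]. Qed.

Lemma derivable_fill S A B : A ||- B -> fill S A ||- fill S B.
Proof.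
case=> s [+ <-]; elim: s A => [|C s IH] A /=; first by move=> _; apply: derivable_refl.
case=> -[S' [P [Q [PQ -> ->]]]] /IH; apply: derivable_trans.
by rewrite -!fill_comp; apply: derivable_step.
Qed.

Lemma KS1_derivable A B : KS1 A B -> A ||- B.
Proof. by move/(derivable_step (Hole L)). Qed.

Lemma equiv_derivable A B : equiv A B -> A ||- B.
Proof. by move=> AB; apply/KS1_derivable/KS1_equiv/equiv_sym. Qed.

Lemma derivable_And A A' B B' : A ||- A' -> B ||- B' -> And A B ||- And A' B'.
Proof.
move=> /(derivable_fill (CAndl (Hole L) B)) AA' /(derivable_fill (CAndr A' (Hole L))).
exact: derivable_trans.
Qed.

Lemma derivable_Or A A' B B' : A ||- A' -> B ||- B' -> Or A B ||- Or A' B'.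
Proof.
move=> /(derivable_fill (COrl (Hole L) B)) AA' /(derivable_fill (COrr A' (Hole L))).
exact: derivable_trans.
Qed.

Lemma derivable_Ex x A B : A ||- B -> Ex x A ||- Ex x B.
Proof. by move/(derivable_fill (CEx x (Hole L))). Qed.

Lemma derivable_All x A B : A ||- B -> All x A ||- All x B.
Proof. by move/(derivable_fill (CAll x (Hole L))). Qed.

Lemma derivable_OrC A B : Or A B ||- Or B A.
Proof. exact/equiv_derivable/equiv_OrC. Qed.

Lemma derivable_OrA A B C : Or (Or A B) C ||- Or A (Or B C).
Proof. exact/equiv_derivable/equiv_sym/equiv_OrA. Qed.

Lemma derivable_OrACA A B C D : Or (Or A B) (Or C D) ||- Or (Or A C) (Or B D).
Proof.
apply: derivable_trans (derivable_OrA _ _ _) _.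
apply: derivable_trans (equiv_derivable (equiv_OrA _ _ _)).
apply: derivable_Or (derivable_refl _) _.
apply: derivable_trans (equiv_derivable (equiv_OrA _ _ _)) _.
apply: derivable_trans (derivable_OrA _ _ _).
exact: derivable_Or (derivable_OrC _ _) (derivable_refl _).
Qed.

(** The medial rules push the disjunction of two copies inwards through conjunctions and
    quantifiers, and a disjunction only needs regrouping; at the leaves [KS1_ac] applies. *)
Lemma derivable_contraction A : Or A A ||- A.
Proof.
elim: A => [a|A IHA B IHB|A IHA B IHB|x A IHA|x A IHA].
- exact/KS1_derivable/KS1_ac.
- exact: derivable_trans (KS1_derivable (KS1_m _ _ _ _)) (derivable_And IHA IHB).
- exact: derivable_trans (derivable_OrACA _ _ _ _) (derivable_Or IHA IHB).
- exact: derivable_trans (KS1_derivable (KS1_mexists _ _ _)) (derivable_Ex x IHA).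
- exact: derivable_trans (KS1_derivable (KS1_mforall _ _ _)) (derivable_All x IHA).
Qed.

Lemma derivable_Orl A B : A ||- Or A B.
Proof. exact/KS1_derivable/KS1_w. Qed.

Lemma derivable_Orr A B : B ||- Or A B.
Proof. exact: derivable_trans (derivable_Orl _ _) (derivable_OrC _ _). Qed.

Lemma derivable_Or_elim A B C : A ||- C -> B ||- C -> Or A B ||- C.
Proof.
move=> AC /(derivable_Or AC)/derivable_trans; apply.
exact: derivable_contraction.
Qed.

Local Notation provable := (provable (@KS1 L)).

Lemma provable_ai a : provable (Or (Atom a) (Atom (dual_atom a))).
Proof. exact/KS1_derivable/KS1_ai. Qed.

(** Conjoin the two premises, let [KS1_s] extract one copy of [G] from each, and contract the
    copies. *)
Lemma provable_OrAnd G A B :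
  provable (Or G A) -> provable (Or G B) -> provable (Or G (And A B)).
Proof.
move=> GA GB; apply: derivable_trans (KS1_derivable (KS1_t _)) _.
apply: derivable_trans (derivable_And GA (derivable_trans GB (derivable_OrC _ _))) _.
apply: derivable_trans (KS1_derivable (KS1_s _ _ _)) _.
apply: derivable_Or_elim (derivable_Orl _ _).
apply: derivable_trans (equiv_derivable (equiv_AndC _ _)) _.
apply: derivable_trans (derivable_And (derivable_refl _) (derivable_OrC _ _)) _.
apply: derivable_trans (KS1_derivable (KS1_s _ _ _)) _.
apply: derivable_trans (derivable_OrC _ _) _.
exact: derivable_Or (derivable_refl _) (equiv_derivable (equiv_AndC _ _)).
Qed.

(** The whole proof is carried out under a quantifier on [y] over truth; [G] then leaves its scope,
    and [y] is renamed to [x]. *)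
Lemma provable_OrAll G A x y : y \notin free_vars G -> y \notin free_vars A ->
  provable (Or G (subst A x (Var y))) -> provable (Or G (All x A)).
Proof.
move=> yG yA GA; apply: derivable_trans (KS1_derivable (KS1_forall y)) _.
apply: derivable_trans (derivable_All y (derivable_trans GA (derivable_OrC _ _))) _.
apply: derivable_trans (equiv_derivable (equiv_AllOr _ yG)) _.
apply: derivable_trans (derivable_OrC _ _) _.
apply: derivable_Or (derivable_refl _) _.
exact/equiv_derivable/equiv_sym/equiv_alpha_All.
Qed.

(** With [A0] as base of the fold, it is a disjunct of every such formula. *)
Definition disj A0 (Gamma : seq (formula L)) : formula L := foldr (@Or L) A0 Gamma.

Lemma derivable_disj_intro A0 Gamma A : A \in A0 :: Gamma -> A ||- disj A0 Gamma.
Proof.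
elim: Gamma => [|B Gamma IH]; first by rewrite inE => /eqP ->; apply: derivable_refl.
rewrite !inE orbCA => /orP[/eqP ->|AG]; first exact: derivable_Orl.
apply: derivable_trans (derivable_Orr _ _).
by apply: IH; rewrite inE.
Qed.

Lemma derivable_disj_elim A0 Gamma C :
  {in A0 :: Gamma, forall A, A ||- C} -> disj A0 Gamma ||- C.
Proof.
elim: Gamma => [|B Gamma IH] GC; first by apply: GC; rewrite inE.
apply: derivable_Or_elim; first by apply: GC; rewrite !inE eqxx orbT.
by apply: IH => A AG; apply: GC; move: AG; rewrite !inE orbCA => ->; rewrite orbT.
Qed.

Lemma derivable_disj_sub A0 Gamma Delta :
  {subset Gamma <= A0 :: Delta} -> disj A0 Gamma ||- disj A0 Delta.
Proof.
move=> GD; apply: derivable_disj_elim => A AG; apply: derivable_disj_intro.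
by move: AG; rewrite inE => /orP[/eqP ->|/GD //]; rewrite inE eqxx.
Qed.

End Derivability.

(** * Term model of a dual Hintikka set *)

Section TermModel.
Variable L : signature.

(** The type of the argument tuple depends on the symbol, and [dual (dual p)] equals [p] only
    propositionally, hence the cast. *)
Lemma APred_congr (p q : psym L) (ts : {ffun 'I_(parity p) -> term L})
    (us : {ffun 'I_(parity q) -> term L}) (pq : p = q) :
  (forall i, ts i = us (cast_ord (congr1 (@parity L) pq) i)) -> APred ts = APred us.
Proof.
case: q / pq us => us tus; congr APred; apply/ffunP => i.
by rewrite tus cast_ord_id.
Qed.

Lemma dual_atomK : involutive (@dual_atom L).
Proof.
case=> [||p ts] //=; apply: (APred_congr (pq := dualK p)) => i.
by rewrite !ffunE; congr (ts _); apply: val_inj.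
Qed.

Variable H : formula L -> Prop.

(* Exactly one of [p] and [dual p] is declared positive. Its atoms are true   *)
(* unless they are in [H], and this dictates the interpretation of its dual.  *)
Definition positive (p : psym L) : bool := pickle p < pickle (dual p).

Lemma positive_dual p : positive (dual p) = ~~ positive p.
Proof.
rewrite /positive dualK -leqNgt ltn_neqAle; case: eqP => //=.
by move/(pcan_inj (@pickleK _))/eqP; rewrite (negbTE (dual_neq p)).
Qed.

Definition term_pint (p : psym L) (ts : {ffun 'I_(parity p) -> term L}) : Prop :=
  if positive p then ~ H (Atom (APred ts)) else H (Atom (dual_atom (APred ts))).

Lemma term_pint_dual (p : psym L) (ts : {ffun 'I_(parity p) -> term L}) :
  @term_pint (dual p) [ffun i => ts (cast_ord (parity_dual p) i)] <->
  ~ term_pint ts.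
Proof.
rewrite /term_pint positive_dual.
rewrite -[APred [ffun i => _]]/(dual_atom (APred ts)) dual_atomK.
by case: positive; rewrite // notE.
Qed.

Definition term_model : structure L :=
  Structure (inhabits (default_term L)) (fun f ts => App ts) term_pint_dual.

Lemma eval_term_model (t : term L) : eval (M := term_model) (@Var L) t = t.
Proof.
elim/term_nested_ind: t => //= f ts IH; congr App.
by apply/ffunP => i; rewrite ffunE IH.
Qed.

Lemma holds_term_model_subst A x t :
  holds (M := term_model) (@Var L) (subst A x t) <->
  holds (M := term_model) (fun y => if y == x then t else Var y) A.
Proof. by rewrite holds_subst eval_term_model. Qed.

(** An induction measure for instances of quantified formulas, which are not subformulas: it ignores
    terms, so substitution preserves it. *)
Fixpoint depth (A : formula L) : nat :=
  match A with
  | Atom _ => 0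
  | And B C | Or B C => (maxn (depth B) (depth C)).+1
  | Ex _ B | All _ B => (depth B).+1
  end.

Lemma depth_msubst s A : depth (msubst s A) = depth A.
Proof.
by elim: A s => //= [B IHB C IHC|B IHB C IHC|x B IHB|x B IHB] s; rewrite ?IHB ?IHC.
Qed.

(* Members of [H] are meant to be refuted, so the closure conditions are dual *)
(* to those of a Hintikka set.                                                *)
Record dual_hintikka : Prop := DualHintikka {
  dual_hintikka_true : ~ H (ftrue L);
  dual_hintikka_dual : forall a, H (Atom a) -> ~ H (Atom (dual_atom a));
  dual_hintikka_And : forall A B, H (And A B) -> H A \/ H B;
  dual_hintikka_Or : forall A B, H (Or A B) -> H A /\ H B;
  dual_hintikka_Ex : forall x A t, H (Ex x A) -> H (subst A x t);
  dual_hintikka_All : forall x A,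
    H (All x A) -> exists y, H (subst A x (Var y)) }.

Lemma dual_hintikka_refuted : dual_hintikka ->
  forall A, H A -> ~ holds (M := term_model) (@Var L) A.
Proof.
case=> Htrue Hdual HAnd HOr HEx HAll A.
have [n] := ubnP (depth A); elim: n A => // n IH.
case=> [[||p ts]|B C|B C|x B|x B] /=; rewrite ?ltnS ?gtn_max.
- by move=> _ /Htrue.
- by move=> _ _.
- move=> _ Hp; rewrite (_ : [ffun i => eval (M := term_model) _ _] = ts); last first.
    by apply/ffunP => i; rewrite ffunE eval_term_model.
  rewrite /term_pint; case: positive; first by apply.
  exact: Hdual.
- by move=> /andP[Bn Cn] /HAnd[/(IH _ Bn) nB|/(IH _ Cn) nC] [].
- by move=> /andP[Bn Cn] /HOr[/(IH _ Bn) nB /(IH _ Cn) nC] [].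
- move=> Bn HB [t /holds_term_model_subst]; apply: IH; last exact: HEx.
  by rewrite depth_msubst.
- move=> Bn /HAll[y Hy] HB; apply: (IH _ _ Hy); first by rewrite depth_msubst.
  exact/holds_term_model_subst.
Qed.

End TermModel.

(** * Maximal unprovable set and completeness *)

Section Completeness.
Variables (L : signature) (A0 : formula L).
Implicit Types (A B F G : formula L) (Gamma : seq (formula L)).

Local Notation "A ||- B" := (derivable (@KS1 L) A B) (at level 70).
Local Notation provable := (provable (@KS1 L)).
Local Notation D := (disj A0).

Hypothesis A0_unprovable : ~ provable A0.

Definition witness F Gamma : seq (formula L) :=
  if F is All x A then
    let y := xchoose (var_infinite (free_vars (D (F :: Gamma)) ++ free_vars A)) in
    [:: subst A x (Var y)]
  else [::].

(** By freshness the witness can be generalized back to [All x A], which is already a disjunct and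
    absorbs it. *)
Lemma provable_witness F Gamma :
  provable (D (witness F Gamma ++ F :: Gamma)) -> provable (D (F :: Gamma)).
Proof.
case: F => //= x A WG.
set G := Or (All x A) (foldr (@Or L) A0 Gamma) in WG *.
set y := xchoose _ in WG; have := xchooseP (var_infinite (free_vars G ++ free_vars A)).
rewrite -/y mem_cat negb_or => /andP[yG yA].
have GW := derivable_trans WG (derivable_OrC _ _).
apply: derivable_trans (provable_OrAll yG yA GW) _.
exact: derivable_Or_elim (derivable_refl _) (derivable_Orl _ _).
Qed.

Definition step n Gamma : seq (formula L) :=
  if unpickle n is Some F then
    if `[< provable (D (F :: Gamma)) >] then Gamma
    else witness F Gamma ++ F :: Gamma
  else Gamma.

Definition stage n : seq (formula L) := iteri n step [::].

Lemma stage_unprovable n : ~ provable (D (stage n)).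
Proof.
elim: n => // n IH; rewrite /= /step; case: unpickle => // F.
by case: asboolP => // nF /provable_witness.
Qed.

Lemma stage_pickle F : ~ provable (D (F :: stage (pickle F))) ->
  stage (pickle F).+1 = witness F (stage (pickle F)) ++ F :: stage (pickle F).
Proof.
by rewrite [stage _.+1]/= {1}/step pickleK; case: asboolP.
Qed.

Lemma stage_sub m n : m <= n -> {subset stage m <= stage n}.
Proof.
move=> /subnKC <-; elim: (n - m) => [|k IH]; first by rewrite addn0.
move=> F /IH Fm; rewrite addnS /= /step; case: unpickle => // G.
by case: ifP => // _; rewrite mem_cat inE Fm !orbT.
Qed.

Definition limit F : Prop := exists n, F \in stage n.

Lemma limit_sub_stage Gamma :
  {in Gamma, forall F, limit F} -> exists n, {subset Gamma <= stage n}.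
Proof.
elim: Gamma => [|F Gamma IH] HG; first by exists 0.
have [|m Gm] := IH; first by move=> G GG; apply: HG; rewrite inE GG orbT.
have [|n Fn] := HG F; first by rewrite inE eqxx.
exists (maxn m n) => G; rewrite inE => /orP[/eqP ->|/Gm].
  exact: stage_sub (leq_maxr _ _) _ Fn.
exact/stage_sub/leq_maxl.
Qed.

Lemma limit_unprovable Gamma :
  {in Gamma, forall F, limit F} -> ~ provable (D Gamma).
Proof.
move=> /limit_sub_stage[n Gn] GP; apply: (@stage_unprovable n).
apply: derivable_trans GP _; apply: derivable_disj_sub => F /Gn Fn.
by rewrite inE Fn orbT.
Qed.

Lemma in_stage_limit n : {in stage n, forall F, limit F}.
Proof. by move=> F Fn; exists n. Qed.

(** A formula is missing only if it was refused at its own turn, [pickle F]; the stage of that turn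
    is the required [Gamma]. *)
Lemma limit_maximal F : ~ limit F ->
  exists Gamma, {in Gamma, forall G, limit G} /\ provable (D (F :: Gamma)).
Proof.
move=> nF; exists (stage (pickle F)); split; first exact: in_stage_limit.
apply: contrapT => FG; apply: nF; exists (pickle F).+1.
by rewrite stage_pickle // mem_cat inE eqxx orbT.
Qed.

Lemma limit_base : limit A0.
Proof.
apply: contrapT => /limit_maximal[Gamma [HG]] AG; apply: (limit_unprovable HG).
apply: derivable_trans AG _; apply: derivable_Or_elim (derivable_refl _).
by apply: derivable_disj_intro; rewrite inE eqxx.
Qed.

(** If [G] were missing, some finite part of [limit] would be provable together with [G], hence
    together with [F]. *)
Lemma limit_derivable F G : G ||- F -> limit F -> limit G.
Proof.
move=> GF HF; apply: contrapT => /limit_maximal[Gamma [HG GG]].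
apply: (@limit_unprovable (F :: Gamma)).
  by move=> B; rewrite inE => /orP[/eqP ->|/HG].
exact: derivable_trans GG (derivable_Or GF (derivable_refl _)).
Qed.

(** If both conjuncts were missing, the two refusing sets, merged by weakening, would prove the
    conjunction by [provable_OrAnd]. *)
Lemma limit_And A B : limit (And A B) -> limit A \/ limit B.
Proof.
move=> HAB; apply: contrapT => /not_orP[].
move=> /limit_maximal[Gamma [HG AG]] /limit_maximal[Delta [HD BD]].
apply: (@limit_unprovable (And A B :: Gamma ++ Delta)).
  by move=> F; rewrite inE mem_cat => /or3P[/eqP ->|/HG|/HD].
have weaken F Sigma : {subset Sigma <= Gamma ++ Delta} ->
    provable (D (F :: Sigma)) -> provable (Or (D (Gamma ++ Delta)) F).
  move=> sub FS; apply: derivable_trans FS _.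
  apply: derivable_trans (derivable_OrC _ _) _.
  apply: derivable_Or (derivable_refl _); apply: derivable_disj_sub => G /sub GS.
  by rewrite inE GS orbT.
apply: derivable_trans (derivable_OrC _ _); apply: provable_OrAnd.
  by apply: weaken AG => F FG; rewrite mem_cat FG.
by apply: weaken BD => F FD; rewrite mem_cat FD orbT.
Qed.

Lemma limit_All x A : limit (All x A) -> exists y, limit (subst A x (Var y)).
Proof.
move=> HA.
(* However [All x A] first entered, its own turn still comes; it cannot be refused then, since it
   and the stage lie in [limit], and the step adds its witness. *)
have HW : {in witness (All x A) (stage (pickle (All x A))), forall F, limit F}.
  move=> F FW; exists (pickle (All x A)).+1; rewrite stage_pickle ?mem_cat ?FW //.
  by apply: limit_unprovable => G; rewrite inE => /orP[/eqP ->|/in_stage_limit].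
by eexists; apply: HW; rewrite inE.
Qed.

Lemma limit_dual_hintikka : dual_hintikka limit.
Proof.
apply: DualHintikka => [Ht|a Ha Hda|A B|A B HAB|x A t|x A].
- apply: (@limit_unprovable [:: ftrue L]); first by move=> F; rewrite inE => /eqP ->.
  exact: derivable_Orl.
- apply: (@limit_unprovable [:: Atom a; Atom (dual_atom a)]).
    by move=> F; rewrite !inE => /orP[] /eqP ->.
  apply: derivable_trans (provable_ai a) _.
  exact: derivable_Or (derivable_refl _) (derivable_Orl _ _).
- exact: limit_And.
- by split; apply: limit_derivable HAB; [apply: derivable_Orl | apply: derivable_Orr].
- by apply: limit_derivable; apply: KS1_derivable; apply: KS1_exists.
- exact: limit_All.
Qed.

Lemma not_valid_base : ~ valid A0.
Proof.
move=> /(_ (term_model limit) (@Var L)).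
exact: dual_hintikka_refuted limit_dual_hintikka _ limit_base.
Qed.

End Completeness.

Theorem theorem6p1 (L : signature) (A : formula L) :
  provable (@KS1 L) A <-> valid A.
Proof.
split=> [A_provable M e|A_valid]; first exact: (derivable_sound A_provable).
by apply: contrapT => /not_valid_base.
Qed.
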